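(* (Equivalence between $\mathrm{NLT}_{\omega}$ and $\mathrm{SLT}_{\omega}$.) For every formula $\alpha$, the sequent $\Rightarrow\alpha$ (empty antecedent) is derivable in $\mathrm{SLT}_{\omega}$ if and only if $\alpha$ is provable in $\mathrm{NLT}_{\omega}$, i.e. there is a derivation in $\mathrm{NLT}_{\omega}$ with no open assumptions whose end-formula is $\alpha$.
   Context: Formulas are built from countably many propositional variables using binary $\to,\wedge,\vee$ and unary $\neg,\mathrm{G},\mathrm{F},\mathrm{X}$; $\mathrm{X}^0\alpha:=\alpha$, $\mathrm{X}^{n+1}\alpha:=\mathrm{X}^n\mathrm{X}\alpha$. In all rules below $i,j,k$ are arbitrary natural numbers. $\mathrm{SLT}_{\omega}$: sequents $\Gamma\Rightarrow\gamma$, $\Gamma$ a finite set of formulas, $\gamma$ a formula or empty; derivations are well-founded, possibly infinitely branching trees. Initial sequents $\mathrm{X}^ip,\Gamma\Rightarrow\mathrm{X}^ip$ ($p$ a propositional variable). Rules: (cut) from $\Gamma\Rightarrow\alpha$ and $\alpha,\Sigma\Rightarrow\gamma$ infer $\Gamma,\Sigma\Rightarrow\gamma$; (we-right) from $\Gamma\Rightarrow$ infer $\Gamma\Rightarrow\alpha$; ($\to$left) from $\Gamma\Rightarrow\mathrm{X}^i\alpha$ and $\mathrm{X}^i\beta,\Gamma\Rightarrow\gamma$ infer $\mathrm{X}^i(\alpha\to\beta),\Gamma\Rightarrow\gamma$; ($\to$right) from $\mathrm{X}^i\alpha,\Gamma\Rightarrow\mathrm{X}^i\beta$ infer $\Gamma\Rightarrow\mathrm{X}^i(\alpha\to\beta)$;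 ($\neg$left) from $\Gamma\Rightarrow\mathrm{X}^i\alpha$ infer $\mathrm{X}^i\neg\alpha,\Gamma\Rightarrow$; ($\neg$right) from $\mathrm{X}^i\alpha,\Gamma\Rightarrow$ infer $\Gamma\Rightarrow\mathrm{X}^i\neg\alpha$; (ex-middle) from $\mathrm{X}^i\neg\alpha,\Gamma\Rightarrow\gamma$ and $\mathrm{X}^i\alpha,\Gamma\Rightarrow\gamma$ infer $\Gamma\Rightarrow\gamma$; ($\wedge$left) from $\mathrm{X}^i\alpha,\mathrm{X}^i\beta,\Gamma\Rightarrow\gamma$ infer $\mathrm{X}^i(\alpha\wedge\beta),\Gamma\Rightarrow\gamma$; ($\wedge$right) from $\Gamma\Rightarrow\mathrm{X}^i\alpha$ and $\Gamma\Rightarrow\mathrm{X}^i\beta$ infer $\Gamma\Rightarrow\mathrm{X}^i(\alpha\wedge\beta)$; ($\vee$left) from $\mathrm{X}^i\alpha,\Gamma\Rightarrow\gamma$ and $\mathrm{X}^i\beta,\Gamma\Rightarrow\gamma$ infer $\mathrm{X}^i(\alpha\vee\beta),\Gamma\Rightarrow\gamma$; ($\vee$right1/2) from $\Gamma\Rightarrow\mathrm{X}^i\alpha$ (resp. $\Gamma\Rightarrow\mathrm{X}^i\beta$) infer $\Gamma\Rightarrow\mathrm{X}^i(\alpha\vee\beta)$; (Gleft) from $\mathrm{X}^{i+k}\alpha,\Gamma\Rightarrow\gamma$ infer $\mathrm{X}^i\mathrm{G}\alpha,\Gamma\Rightarrow\gamma$; (Gright) from all $\Gamma\Rightarrow\mathrm{X}^{i+j}\alpha$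 ($j\in\omega$) infer $\Gamma\Rightarrow\mathrm{X}^i\mathrm{G}\alpha$; (Fleft) from all $\mathrm{X}^{i+j}\alpha,\Gamma\Rightarrow\gamma$ ($j\in\omega$) infer $\mathrm{X}^i\mathrm{F}\alpha,\Gamma\Rightarrow\gamma$; (Fright) from $\Gamma\Rightarrow\mathrm{X}^{i+k}\alpha$ infer $\Gamma\Rightarrow\mathrm{X}^i\mathrm{F}\alpha$. $\mathrm{NLT}_{\omega}$ is a natural deduction system (derivations are well-founded, possibly infinitely branching trees of formulas, with assumptions that may be discharged, $[\cdot]$ marking discharged assumptions) with rules: ($\to$I) from a derivation of $\mathrm{X}^i\beta$ infer $\mathrm{X}^i(\alpha\to\beta)$ discharging $\mathrm{X}^i\alpha$ (discharge may be vacuous); ($\to$E) from $\mathrm{X}^i(\alpha\to\beta)$ and $\mathrm{X}^i\alpha$ infer $\mathrm{X}^i\beta$; (EXP) from $\mathrm{X}^i\neg\alpha$ and $\mathrm{X}^i\alpha$ infer any $\gamma$; (EXM) from a derivation of $\gamma$ from $[\mathrm{X}^i\neg\alpha]$ and a derivation of $\gamma$ from $[\mathrm{X}^i\alpha]$ infer $\gamma$, discharging both; ($\neg$I) from a derivation of $\mathrm{X}^j\neg\gamma$ from $[\mathrm{X}^i\alpha]$ and a derivation of $\mathrm{X}^j\gamma$ from $[\mathrm{X}^i\alpha]$ infer $\mathrm{X}^i\neg\alpha$; ($\wedge$I) from $\mathrm{X}^i\alpha$ and $\mathrm{X}^i\beta$ infer $\mathrm{X}^i(\alpha\wedge\beta)$;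 ($\wedge$E1/2) from $\mathrm{X}^i(\alpha\wedge\beta)$ infer $\mathrm{X}^i\alpha$ (resp. $\mathrm{X}^i\beta$); ($\vee$I1/2) from $\mathrm{X}^i\alpha$ (resp. $\mathrm{X}^i\beta$) infer $\mathrm{X}^i(\alpha\vee\beta)$; ($\vee$E) from $\mathrm{X}^i(\alpha\vee\beta)$, a derivation of $\gamma$ from $[\mathrm{X}^i\alpha]$ and a derivation of $\gamma$ from $[\mathrm{X}^i\beta]$ infer $\gamma$; (GI) from all $\mathrm{X}^{i+j}\alpha$ ($j\in\omega$) infer $\mathrm{X}^i\mathrm{G}\alpha$; (GE) from $\mathrm{X}^i\mathrm{G}\alpha$ infer $\mathrm{X}^{i+k}\alpha$; (FI) from $\mathrm{X}^{i+k}\alpha$ infer $\mathrm{X}^i\mathrm{F}\alpha$; (FE) from $\mathrm{X}^i\mathrm{F}\alpha$ and, for every $j\in\omega$, a derivation of $\gamma$ from $[\mathrm{X}^{i+j}\alpha]$, infer $\gamma$. *)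

(* Defs.v *)
From HB Require Import structures.
From mathcomp Require Import all_boot finmap.
From mathcomp Require Import mathcomp_extra boolp classical_sets.

Set Implicit Arguments.
Unset Strict Implicit.
Unset Printing Implicit Defensive.

Inductive formula : Type :=
| Var of nat
| Imp of formula & formula
| And of formula & formula
| Or of formula & formula
| Neg of formula
| G of formula
| F of formula
| X of formula.

(* A choiceType structure on formulas is needed to form {fset formula}. *)
Fixpoint tree_of_formula (a : formula) : GenTree.tree nat :=
  match a with
  | Var p => GenTree.Leaf p
  | Imp b c => GenTree.Node 0 [:: tree_of_formula b; tree_of_formula c]
  | And b c => GenTree.Node 1 [:: tree_of_formula b; tree_of_formula c]
  | Or b c => GenTree.Node 2 [:: tree_of_formula b; tree_of_formula c]
  | Neg b => GenTree.Node 3 [:: tree_of_formula b]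
  | G b => GenTree.Node 4 [:: tree_of_formula b]
  | F b => GenTree.Node 5 [:: tree_of_formula b]
  | X b => GenTree.Node 6 [:: tree_of_formula b]
  end.

Fixpoint formula_of_tree (t : GenTree.tree nat) : formula :=
  match t with
  | GenTree.Leaf p => Var p
  | GenTree.Node 0 [:: b; c] => Imp (formula_of_tree b) (formula_of_tree c)
  | GenTree.Node 1 [:: b; c] => And (formula_of_tree b) (formula_of_tree c)
  | GenTree.Node 2 [:: b; c] => Or (formula_of_tree b) (formula_of_tree c)
  | GenTree.Node 3 [:: b] => Neg (formula_of_tree b)
  | GenTree.Node 4 [:: b] => G (formula_of_tree b)
  | GenTree.Node 5 [:: b] => F (formula_of_tree b)
  | GenTree.Node 6 [:: b] => X (formula_of_tree b)
  | _ => Var 0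
  end.

Lemma tree_of_formulaK : cancel tree_of_formula formula_of_tree.
Proof. by elim=> //= [b -> c ->|b -> c ->|b -> c ->|b ->|b ->|b ->|b ->]. Qed.

HB.instance Definition _ := Countable.copy formula (can_type tree_of_formulaK).

Fixpoint Xn (n : nat) (a : formula) : formula :=
  if n is m.+1 then Xn m (X a) else a.

(* [SLT Gam c]: the sequent Gam => c is derivable; [None] is the empty
   succedent.  The formula displayed to the left of Gam in a rule may already
   belong to Gam, as antecedents are sets. *)
Inductive SLT : {fset formula} -> option formula -> Prop :=
| SLT_init i p Gam :
    SLT (Xn i (Var p) |` Gam)%fset (Some (Xn i (Var p)))
| SLT_cut a Gam Sig c :
    SLT Gam (Some a) -> SLT (a |` Sig)%fset c -> SLT (Gam `|` Sig)%fset c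
| SLT_we_right a Gam :
    SLT Gam None -> SLT Gam (Some a)
| SLT_imp_left i a b Gam c :
    SLT Gam (Some (Xn i a)) -> SLT (Xn i b |` Gam)%fset c ->
    SLT (Xn i (Imp a b) |` Gam)%fset c
| SLT_imp_right i a b Gam :
    SLT (Xn i a |` Gam)%fset (Some (Xn i b)) -> SLT Gam (Some (Xn i (Imp a b)))
| SLT_neg_left i a Gam :
    SLT Gam (Some (Xn i a)) -> SLT (Xn i (Neg a) |` Gam)%fset None
| SLT_neg_right i a Gam :
    SLT (Xn i a |` Gam)%fset None -> SLT Gam (Some (Xn i (Neg a)))
| SLT_ex_middle i a Gam c :
    SLT (Xn i (Neg a) |` Gam)%fset c -> SLT (Xn i a |` Gam)%fset c -> SLT Gam c
| SLT_and_left i a b Gam c :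
    SLT (Xn i a |` (Xn i b |` Gam))%fset c -> SLT (Xn i (And a b) |` Gam)%fset c
| SLT_and_right i a b Gam :
    SLT Gam (Some (Xn i a)) -> SLT Gam (Some (Xn i b)) ->
    SLT Gam (Some (Xn i (And a b)))
| SLT_or_left i a b Gam c :
    SLT (Xn i a |` Gam)%fset c -> SLT (Xn i b |` Gam)%fset c ->
    SLT (Xn i (Or a b) |` Gam)%fset c
| SLT_or_right1 i a b Gam :
    SLT Gam (Some (Xn i a)) -> SLT Gam (Some (Xn i (Or a b)))
| SLT_or_right2 i a b Gam :
    SLT Gam (Some (Xn i b)) -> SLT Gam (Some (Xn i (Or a b)))
| SLT_G_left i k a Gam c :
    SLT (Xn (i + k) a |` Gam)%fset c -> SLT (Xn i (G a) |` Gam)%fset c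
| SLT_G_right i a Gam :
    (forall j, SLT Gam (Some (Xn (i + j) a))) -> SLT Gam (Some (Xn i (G a)))
| SLT_F_left i a Gam c :
    (forall j, SLT (Xn (i + j) a |` Gam)%fset c) ->
    SLT (Xn i (F a) |` Gam)%fset c
| SLT_F_right i k a Gam :
    SLT Gam (Some (Xn (i + k) a)) -> SLT Gam (Some (Xn i (F a))).

(* Derivation trees with given end-formula.  Each assumption carries a label
   [n : nat], and a discharging rule labelled [n] discharges exactly the
   assumptions of the displayed formula labelled [n].  Labels allow vacuous and
   partial discharge; every closed derivation is represented, since each
   discharging inference can be labelled with its (finite) distance to the
   root. *)
Inductive NLT : formula -> Type :=
| NLT_assume (n : nat) a : NLT a
| NLT_impI (n : nat) i a b : NLT (Xn i b) -> NLT (Xn i (Imp a b))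
| NLT_impE i a b : NLT (Xn i (Imp a b)) -> NLT (Xn i a) -> NLT (Xn i b)
| NLT_exp i a c : NLT (Xn i (Neg a)) -> NLT (Xn i a) -> NLT c
| NLT_exm (n i : nat) (a : formula) c : NLT c -> NLT c -> NLT c
| NLT_negI (n : nat) i j a c :
    NLT (Xn j (Neg c)) -> NLT (Xn j c) -> NLT (Xn i (Neg a))
| NLT_andI i a b : NLT (Xn i a) -> NLT (Xn i b) -> NLT (Xn i (And a b))
| NLT_andE1 i a b : NLT (Xn i (And a b)) -> NLT (Xn i a)
| NLT_andE2 i a b : NLT (Xn i (And a b)) -> NLT (Xn i b)
| NLT_orI1 i a b : NLT (Xn i a) -> NLT (Xn i (Or a b))
| NLT_orI2 i a b : NLT (Xn i b) -> NLT (Xn i (Or a b))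
| NLT_orE (n : nat) i a b c : NLT (Xn i (Or a b)) -> NLT c -> NLT c -> NLT c
| NLT_GI i a : (forall j, NLT (Xn (i + j) a)) -> NLT (Xn i (G a))
| NLT_GE i k a : NLT (Xn i (G a)) -> NLT (Xn (i + k) a)
| NLT_FI i k a : NLT (Xn (i + k) a) -> NLT (Xn i (F a))
| NLT_FE (n : nat) i a c : NLT (Xn i (F a)) -> (nat -> NLT c) -> NLT c.

Local Open Scope classical_set_scope.

Fixpoint open_assumptions (a : formula) (d : NLT a) : set (nat * formula) :=
  match d with
  | NLT_assume n a => [set (n, a)]
  | NLT_impI n i a b d1 => open_assumptions d1 `\ (n, Xn i a)
  | NLT_impE _ _ _ d1 d2 => open_assumptions d1 `|` open_assumptions d2
  | NLT_exp _ _ _ d1 d2 => open_assumptions d1 `|` open_assumptions d2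
  | NLT_exm n i a _ d1 d2 =>
      (open_assumptions d1 `\ (n, Xn i (Neg a)))
      `|` (open_assumptions d2 `\ (n, Xn i a))
  | NLT_negI n i _ a _ d1 d2 =>
      (open_assumptions d1 `\ (n, Xn i a))
      `|` (open_assumptions d2 `\ (n, Xn i a))
  | NLT_andI _ _ _ d1 d2 => open_assumptions d1 `|` open_assumptions d2
  | NLT_andE1 _ _ _ d1 => open_assumptions d1
  | NLT_andE2 _ _ _ d1 => open_assumptions d1
  | NLT_orI1 _ _ _ d1 => open_assumptions d1
  | NLT_orI2 _ _ _ d1 => open_assumptions d1
  | NLT_orE n i a b _ d0 d1 d2 =>
      open_assumptions d0
      `|` ((open_assumptions d1 `\ (n, Xn i a))
           `|` (open_assumptions d2 `\ (n, Xn i b)))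
  | NLT_GI _ _ ds => \bigcup_j open_assumptions (ds j)
  | NLT_GE _ _ _ d1 => open_assumptions d1
  | NLT_FI _ _ _ d1 => open_assumptions d1
  | NLT_FE n i a _ d0 ds =>
      open_assumptions d0
      `|` \bigcup_j (open_assumptions (ds j) `\ (n, Xn (i + j) a))
  end.

Definition NLT_provable (a : formula) : Prop :=
  exists d : NLT a, open_assumptions d = set0.

(* Main.v *)
(** Every subderivation of a closed natural deduction lies at finite distance
    from the root, and each inference on the way discharges at most one formula
    per branch; so, reading the tree from the root upwards, a finite antecedent
    always contains the open assumptions, even in the presence of infinitely
    branching rules.  Eliminations are then simulated by left rules and cuts.  Conversely
    a sequent is read as a derivation all of whose open assumptions carry the
    label 0 and belong to the antecedent, an empty succedent meaning that every
    formula is so derivable; left rules are eliminations, and cut is a detour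
    through an implication. *)

Require Import Defs.
From mathcomp Require Import all_boot finmap.
From mathcomp Require Import boolp classical_sets.

Set Implicit Arguments.
Unset Strict Implicit.
Unset Printing Implicit Defensive.

Local Open Scope fset_scope.

(** * From natural deduction to sequents *)

(** Initial sequents cover variables only, so compound formulas need an induction on [a]. The index
    [i] stays general: in the [X] case [Xn i (X a)] is [Xn i.+1 a] by computation, and [G] and [F]
    use the hypothesis at every [i + j]. *)
Lemma SLT_identity_Xn a : forall i Gam, SLT (Xn i a |` Gam) (Some (Xn i a)).
Proof.
elim: a => [p|a IHa b IHb|a IHa b IHb|a IHa b IHb|a IHa|a IHa|a IHa|a IHa] i Gam.
- exact: SLT_init.
- apply: SLT_imp_right; rewrite fsetUCA; apply: SLT_imp_left; first exact: IHa.
  exact: IHb.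
- apply: SLT_and_left; apply: SLT_and_right; first exact: IHa.
  by rewrite fsetUCA; exact: IHb.
- by apply: SLT_or_left; [apply: SLT_or_right1 | apply: SLT_or_right2].
- by apply: SLT_neg_right; rewrite fsetUCA; apply: SLT_neg_left.
- by apply: SLT_G_right => j; apply: (@SLT_G_left i j).
- by apply: SLT_F_left => j; apply: (@SLT_F_right i j).
- exact: (IHa i.+1).
Qed.

Lemma SLT_identity a (Gam : {fset formula}) : a \in Gam -> SLT Gam (Some a).
Proof.
by move=> aGam; rewrite -(fsetD1K aGam); exact: (SLT_identity_Xn _ 0).
Qed.

Lemma SLT_cut_shared a Gam c :
  SLT Gam (Some a) -> SLT (a |` Gam) c -> SLT Gam c.
Proof. by move=> Da Dc; rewrite -(fsetUid Gam); exact: SLT_cut Da Dc. Qed.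

Lemma SLT_contradiction i a Gam c :
  SLT Gam (Some (Xn i (Neg a))) -> SLT Gam (Some (Xn i a)) -> SLT Gam c.
Proof.
move=> Dna Da; have DN : SLT Gam None by apply: SLT_cut_shared Dna _; exact: SLT_neg_left.
by case: c => [c|//]; exact: SLT_we_right.
Qed.

(** Labels are forgotten, since an antecedent is a set of formulas. *)
Definition open_within a (d : NLT a) (Gam : {fset formula}) :=
  forall n b, open_assumptions d (n, b) -> b \in Gam.

(** Adding [b] to the antecedent covers the discharged assumptions of [b]; copies of [b] under other
    labels stay open but are covered as well. *)
Lemma subset_discharge (A : set (nat * formula)) n b (Gam : {fset formula}) :
  (forall m c, (A `\ (n, b))%classic (m, c) -> c \in Gam) ->
  forall m c, A (m, c) -> c \in b |` Gam.
Proof.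
move=> sAG m c Ac; rewrite in_fset1U.
have [//|/eqP cb] := eqVneq c b.
by apply: (sAG m); split=> // -[_ /cb].
Qed.

(** By induction on [d]. Asking only for containment in an arbitrary [Gam] lets all premises of a
    rule share one antecedent, which each discharge enlarges by a single formula. *)
Lemma SLT_of_NLT a (d : NLT a) :
  forall Gam, open_within d Gam -> SLT Gam (Some a).
Proof.
rewrite /open_within; elim: d => {a} /=.
- by move=> n a Gam sG; apply: SLT_identity; exact: (sG n).
- move=> n i a b d IH Gam sG; apply: SLT_imp_right; apply: IH.
  exact: subset_discharge sG.
- move=> i a b d1 IH1 d2 IH2 Gam sG.
  apply: (SLT_cut_shared (a := Xn i (Imp a b))).
    by apply: IH1 => n c H; apply: (sG n); left.
  apply: SLT_imp_left; first by apply: IH2 => n c H; apply: (sG n); right.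
  exact: SLT_identity_Xn.
- move=> i a c d1 IH1 d2 IH2 Gam sG; apply: (@SLT_contradiction i a).
    by apply: IH1 => n b H; apply: (sG n); left.
  by apply: IH2 => n b H; apply: (sG n); right.
- move=> n i a c d1 IH1 d2 IH2 Gam sG; apply: (@SLT_ex_middle i a).
    by apply: IH1; apply: (@subset_discharge _ n) => m b H; apply: (sG m); left.
  by apply: IH2; apply: (@subset_discharge _ n) => m b H; apply: (sG m); right.
- move=> n i j a c d1 IH1 d2 IH2 Gam sG; apply: SLT_neg_right.
  apply: (@SLT_contradiction j c).
    by apply: IH1; apply: (@subset_discharge _ n) => m b H; apply: (sG m); left.
  by apply: IH2; apply: (@subset_discharge _ n) => m b H; apply: (sG m); right.
- move=> i a b d1 IH1 d2 IH2 Gam sG; apply: SLT_and_right.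
    by apply: IH1 => n c H; apply: (sG n); left.
  by apply: IH2 => n c H; apply: (sG n); right.
- move=> i a b d IH Gam sG; apply: SLT_cut_shared (IH _ sG) _.
  by apply: SLT_and_left; exact: SLT_identity_Xn.
- move=> i a b d IH Gam sG; apply: SLT_cut_shared (IH _ sG) _.
  by apply: SLT_and_left; rewrite fsetUCA; exact: SLT_identity_Xn.
- by move=> i a b d IH Gam sG; apply: SLT_or_right1; exact: IH.
- by move=> i a b d IH Gam sG; apply: SLT_or_right2; exact: IH.
- move=> n i a b c d0 IH0 d1 IH1 d2 IH2 Gam sG.
  apply: (SLT_cut_shared (a := Xn i (Or a b))).
    by apply: IH0 => m e H; apply: (sG m); left.
  apply: SLT_or_left.
    by apply: IH1; apply: (@subset_discharge _ n) => m e H; apply: (sG m); right; left.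
  by apply: IH2; apply: (@subset_discharge _ n) => m e H; apply: (sG m); right; right.
- move=> i a ds IH Gam sG; apply: SLT_G_right => j; apply: IH => n b H.
  by apply: (sG n); exists j.
- move=> i k a d IH Gam sG; apply: SLT_cut_shared (IH _ sG) _.
  by apply: (@SLT_G_left i k); exact: SLT_identity_Xn.
- by move=> i k a d IH Gam sG; apply: (@SLT_F_right i k); exact: IH.
- move=> n i a c d0 IH0 ds IH Gam sG.
  apply: (SLT_cut_shared (a := Xn i (F a))).
    by apply: IH0 => m e H; apply: (sG m); left.
  apply: SLT_F_left => j; apply: (IH j); apply: (@subset_discharge _ n) => m e H.
  by apply: (sG m); right; exists j.
Qed.

(** * Natural deduction as entailment from finite sets *)

Section Entailment.
Local Open Scope classical_set_scope.

Definition hypotheses (Gam : {fset formula}) : set (nat * formula) :=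
  [set x | x.1 = 0 /\ x.2 \in Gam].

Definition entails Gam a :=
  exists d : NLT a, open_assumptions d `<=` hypotheses Gam.

Lemma subset_hypotheses (A B : {fset formula}) :
  (A `<=` B)%fset -> hypotheses A `<=` hypotheses B.
Proof. by move=> /fsubsetP sAB [n b] [/= -> /sAB]. Qed.

(** With 0 as the only label, discharging [(0, a)] removes every open occurrence of [a]. *)
Lemma discharge_hypotheses (A : set (nat * formula)) a Gam :
  A `<=` hypotheses (a |` Gam)%fset -> A `\ (0, a) `<=` hypotheses Gam.
Proof.
move=> sA [n b] [/sA [/= -> /fset1UP[-> //|]]] //.
Qed.

Lemma entails_weaken (Gam Del : {fset formula}) a :
  (Gam `<=` Del)%fset -> entails Gam a -> entails Del a.
Proof.
move=> /subset_hypotheses sGD [d sd]; exists d; exact: subset_trans sGD.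
Qed.

Lemma entails_assume a (Gam : {fset formula}) : a \in Gam -> entails Gam a.
Proof. by move=> aG; exists (NLT_assume 0 a) => _ ->. Qed.

Lemma entails_impI i a b Gam :
  entails (Xn i a |` Gam)%fset (Xn i b) -> entails Gam (Xn i (Imp a b)).
Proof.
by move=> [d sd]; exists (NLT_impI 0 a d); exact: discharge_hypotheses.
Qed.

Lemma entails_impE i a b Gam :
  entails Gam (Xn i (Imp a b)) -> entails Gam (Xn i a) -> entails Gam (Xn i b).
Proof.
by move=> [d1 s1] [d2 s2]; exists (NLT_impE d1 d2); rewrite /= subUset.
Qed.

Lemma entails_cut a b Gam :
  entails Gam a -> entails (a |` Gam)%fset b -> entails Gam b.
Proof.
(* Index 0 fits because [Xn 0 a] computes to [a]. *)
by move=> Da Db; apply: (@entails_impE 0 a) Da; exact: (@entails_impI 0).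
Qed.

Lemma entails_exp i a c Gam :
  entails Gam (Xn i (Neg a)) -> entails Gam (Xn i a) -> entails Gam c.
Proof.
by move=> [d1 s1] [d2 s2]; exists (NLT_exp c d1 d2); rewrite /= subUset.
Qed.

Lemma entails_exm i a c Gam :
  entails (Xn i (Neg a) |` Gam)%fset c -> entails (Xn i a |` Gam)%fset c ->
  entails Gam c.
Proof.
move=> [d1 s1] [d2 s2]; exists (NLT_exm 0 i a d1 d2).
by rewrite /= subUset; split; exact: discharge_hypotheses.
Qed.

Lemma entails_negI i j a c Gam :
  entails (Xn i a |` Gam)%fset (Xn j (Neg c)) ->
  entails (Xn i a |` Gam)%fset (Xn j c) -> entails Gam (Xn i (Neg a)).
Proof.
move=> [d1 s1] [d2 s2]; exists (NLT_negI 0 i a d1 d2).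
by rewrite /= subUset; split; exact: discharge_hypotheses.
Qed.

Lemma entails_andI i a b Gam :
  entails Gam (Xn i a) -> entails Gam (Xn i b) -> entails Gam (Xn i (And a b)).
Proof.
by move=> [d1 s1] [d2 s2]; exists (NLT_andI d1 d2); rewrite /= subUset.
Qed.

Lemma entails_andE1 i a b Gam :
  entails Gam (Xn i (And a b)) -> entails Gam (Xn i a).
Proof. by move=> [d sd]; exists (NLT_andE1 d). Qed.

Lemma entails_andE2 i a b Gam :
  entails Gam (Xn i (And a b)) -> entails Gam (Xn i b).
Proof. by move=> [d sd]; exists (NLT_andE2 d). Qed.

Lemma entails_orI1 i a b Gam :
  entails Gam (Xn i a) -> entails Gam (Xn i (Or a b)).
Proof. by move=> [d sd]; exists (NLT_orI1 b d). Qed.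

Lemma entails_orI2 i a b Gam :
  entails Gam (Xn i b) -> entails Gam (Xn i (Or a b)).
Proof. by move=> [d sd]; exists (NLT_orI2 a d). Qed.

Lemma entails_orE i a b c Gam :
  entails Gam (Xn i (Or a b)) ->
  entails (Xn i a |` Gam)%fset c -> entails (Xn i b |` Gam)%fset c ->
  entails Gam c.
Proof.
move=> [d0 s0] [d1 s1] [d2 s2]; exists (NLT_orE 0 d0 d1 d2).
rewrite /= !subUset; split=> //.
by split; exact: discharge_hypotheses.
Qed.

Lemma entails_GI i a Gam :
  (forall j, entails Gam (Xn (i + j) a)) -> entails Gam (Xn i (G a)).
Proof.
(* Each premise merely exists; choice turns them into the family of derivations that [NLT_GI]
   takes. *)
move=> H; pose d j := projT1 (cid (H j)).
by exists (NLT_GI d); apply: bigcup_sub => j _; exact: (projT2 (cid (H j))).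
Qed.

Lemma entails_GE i k a Gam :
  entails Gam (Xn i (G a)) -> entails Gam (Xn (i + k) a).
Proof. by move=> [d sd]; exists (NLT_GE k d). Qed.

Lemma entails_FI i k a Gam :
  entails Gam (Xn (i + k) a) -> entails Gam (Xn i (F a)).
Proof. by move=> [d sd]; exists (NLT_FI d). Qed.

Lemma entails_FE i a c Gam :
  entails Gam (Xn i (F a)) ->
  (forall j, entails (Xn (i + j) a |` Gam)%fset c) -> entails Gam c.
Proof.
move=> [d0 s0] H; pose d j := projT1 (cid (H j)).
exists (NLT_FE 0 d0 d); rewrite /= subUset; split=> //.
apply: bigcup_sub => j _; apply: discharge_hypotheses.
exact: (projT2 (cid (H j))).
Qed.

End Entailment.

(** * From sequents to natural deduction *)

(** The guarded target [b] lets left rules be treated uniformly, whether or not the succedent is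
    empty. *)
Definition entails_opt Gam (c : option formula) :=
  forall b, (if c is Some a then b = a else True) -> entails Gam b.

Lemma entails_opt_of_SLT Gam c : SLT Gam c -> entails_opt Gam c.
Proof.
(* Premises of left rules may lack the principal formula; these facts weaken it in, below an active
   formula or directly. *)
have under a b Gam' e :
    entails (b |` Gam') e -> entails (b |` (a |` Gam')) e.
  by apply: entails_weaken; rewrite fsetUS // fsubsetU1.
have keep a Gam' e : entails Gam' e -> entails (a |` Gam') e.
  by apply: entails_weaken; rewrite fsubsetU1.
have hyp a Gam' : entails (a |` Gam') a.
  by apply: entails_assume; rewrite fset1U1.
elim=> {Gam c}.
- by move=> i p Gam _ ->.
- move=> a Gam Sig c _ IH1 _ IH2 b cb; apply: (@entails_cut a).
    by apply: entails_weaken (IH1 _ erefl); exact: fsubsetUl.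
  by apply: entails_weaken (IH2 _ cb); rewrite fsetUS // fsubsetUr.
- by move=> a Gam _ IH _ ->; apply: IH.
- move=> i a b Gam c _ IH1 _ IH2 e ce; apply: (@entails_cut (Xn i b)).
    by apply: (@entails_impE i a) => //; apply: keep; apply: IH1.
  by apply: under; apply: IH2.
- by move=> i a b Gam _ IH _ ->; apply: entails_impI; apply: IH.
- move=> i a Gam _ IH e _; apply: (@entails_exp i a) => //.
  by apply: keep; apply: IH.
- move=> i a Gam _ IH _ ->.
  (* The empty succedent yields every formula, so any contradictory pair serves; here it is [Neg a]
     and [a]. *)
  by apply: (@entails_negI i 0 a a); apply: IH.
- move=> i a Gam c _ IH1 _ IH2 e ce.
  by apply: (@entails_exm i a); [apply: IH1 | apply: IH2].
(* Cutting in the second conjunct first leaves the two conjuncts in the order of the premise. *)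
- move=> i a b Gam c _ IH e ce; apply: (@entails_cut (Xn i b)).
    exact: (@entails_andE2 i a).
  apply: (@entails_cut (Xn i a)); first by apply: keep; exact: (@entails_andE1 i a b).
  by apply: entails_weaken (IH _ ce); rewrite !fsetUS // fsubsetU1.
- by move=> i a b Gam _ IH1 _ IH2 _ ->; apply: entails_andI; [apply: IH1 | apply: IH2].
- move=> i a b Gam c _ IH1 _ IH2 e ce; apply: (@entails_orE i a b) => //.
    by apply: under; apply: IH1.
  by apply: under; apply: IH2.
- by move=> i a b Gam _ IH _ ->; apply: entails_orI1; apply: IH.
- by move=> i a b Gam _ IH _ ->; apply: entails_orI2; apply: IH.
- move=> i k a Gam c _ IH e ce; apply: (@entails_cut (Xn (i + k) a)).
    exact: entails_GE.
  by apply: under; apply: IH.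
- by move=> i a Gam _ IH _ ->; apply: entails_GI => j; apply: IH.
- move=> i a Gam c _ IH e ce; apply: (@entails_FE i a) => // j.
  by apply: under; apply: IH.
- by move=> i k a Gam _ IH _ ->; apply: (@entails_FI i k); apply: IH.
Qed.

Theorem theorem3 (a : formula) :
  SLT fset0 (Some a) <-> NLT_provable a.
Proof.
split=> [/entails_opt_of_SLT /(_ a erefl) [d sd]|[d d0]].
  (* An open assumption would have its formula in [fset0]. *)
  by exists d; rewrite -subset0 => -[n b] /sd [_]; rewrite inE.
by apply: (SLT_of_NLT (d := d)) => n b; rewrite d0.
Qed.
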